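(* Let $T$ be a homeomorphically irreducible tree and let $s,s'$ be $T$-admissible sequences (not necessarily of the same length) with $\mathrm{sig}_s=\mathrm{sig}_{s'}$. Then for every integer $m>\max\{\mathrm{sig}_s(v):v\in V_{br}(T)\}$, the order of any tree induced by $s$ of degree $m$ equals the order of any tree induced by $s'$ of degree $m$.
   Context: A tree is homeomorphically irreducible if it has no vertex of degree two. $V_{br}(T)$ is the set of branch vertices (degree $\ge3$); an arm is a path from a branch vertex to a leaf with no branch vertex in between and an internal path is a path between two branch vertices with no other branch vertex in between; $\mathrm{dist}$ is distance in $T$. A rooted subtree has a designated root $\mathrm{rt}$; $T_\emptyset$ is the empty rooted tree. A $T$-admissible sequence is a finite sequence $t=\langle T_1,\dots,T_l\rangle$ of (possibly empty) rooted subtrees of $T$ such that $\{V(T_i)\}$ is a partition of $V_{br}(T)$ (empty blocks allowed). Its signature is $\mathrm{sig}_t(v)=\mathrm{dist}(v,\mathrm{rt}(T_i))+i$ for $v\in V(T_i)$. For an integer $m>\max\{\mathrm{sig}_t(v)\}$, a tree $T''$ is induced by $t$ of degree $m$ if obtained from $T$ in two stages. Stage 1 (unique tree $T'$): every arm of $T$ attached to a branch vertex $v$ is extended by $m-\mathrm{sig}_t(v)-1$ new vertices; for adjacent branch vertices $v\in V(T_i)$, $v'\in V(T_j)$ with $i\ne j$, the edge joining them is extended by $2m-\mathrm{sig}_t(v)-\mathrm{sig}_t(v')$ new vertices. Stage 2: for each $1\le i\le m$ with $T_i=T_\emptyset$ or $i\ge l+1$, insert $2(m-i)+1$ new vertices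 into some arm or some internal path of $T'$ not of length one (choices arbitrary; the same arm or path may be chosen repeatedly). *)

(* Defs.v *)
From mathcomp Require Import all_boot.

Set Implicit Arguments.
Unset Strict Implicit.
Unset Printing Implicit Defensive.

Record sgraph := SGraph {
  vertex :> finType;
  adj : rel vertex;
  adj_sym : symmetric adj;
  adj_irrefl : irreflexive adj
}.

Definition is_tree (G : sgraph) : Prop :=
  [/\ 0 < #|G|,
      forall x y : G, connect (@adj G) x y
    & forall c : seq G, ucycle (@adj G) c -> size c <= 2].

Definition deg (G : sgraph) (v : G) : nat := #|[set u | adj v u]|.

Definition homeo_irreducible (G : sgraph) : Prop := forall v : G, deg v != 2.

Definition branch (G : sgraph) : {set G} := [set v | 3 <= deg v].

Definition leaf (G : sgraph) (v : G) : bool := deg v == 1.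

(* The least n such that some walk with n edges joins x to y; the default
   value #|G| is only taken when y is not reachable from x. *)
Definition dist (G : sgraph) (x y : G) : nat :=
  find (fun n => [exists p : n.-tuple G, path (@adj G) x p && (last x p == y)])
       (iota 0 #|G|).

(* Paths with at least one edge are given by their first vertex x and the
   sequence p of the following vertices, so that size p is the length. *)
Definition is_path (G : sgraph) (x : G) (p : seq G) : bool :=
  [&& p != [::], path (@adj G) x p & uniq (x :: p)].

Definition interior (G : sgraph) (x : G) (p : seq G) : seq G :=
  behead (belast x p).

Definition path_edges (G : sgraph) (x : G) (p : seq G) : seq {set G} :=
  [seq [set z.1; z.2] | z <- zip (x :: p) p].

Definition arm (G : sgraph) (x : G) (p : seq G) : bool :=
  [&& is_path x p, x \in branch G, leaf (last x p)
    & all [predC branch G] (interior x p)].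

Definition internal_path (G : sgraph) (x : G) (p : seq G) : bool :=
  [&& is_path x p, x \in branch G, last x p \in branch G
    & all [predC branch G] (interior x p)].

Definition sub_adj (G : sgraph) (U : {set G}) : rel {x : G | x \in U} :=
  fun x y => adj (val x) (val y).

Lemma sub_adj_sym (G : sgraph) (U : {set G}) : symmetric (@sub_adj G U).
Proof. by move=> x y; rewrite /sub_adj adj_sym. Qed.

Lemma sub_adj_irrefl (G : sgraph) (U : {set G}) : irreflexive (@sub_adj G U).
Proof. by move=> x; rewrite /sub_adj adj_irrefl. Qed.

Definition subgraph (G : sgraph) (U : {set G}) : sgraph :=
  SGraph (@sub_adj_sym G U) (@sub_adj_irrefl G U).

(* In a tree every connected subgraph is induced, so a subtree is determined by
   its vertex set. *)
Record rooted_subtree (T : sgraph) := RootedSubtree {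
  verts : {set T};
  root : T;
  root_in : root \in verts;
  verts_tree : is_tree (subgraph verts)
}.

(* Possibly empty rooted subtrees: None is the empty rooted tree. *)
Definition rtree (T : sgraph) := option (rooted_subtree T).

Definition rverts (T : sgraph) (R : rtree T) : {set T} :=
  if R is Some R' then verts R' else set0.

(* Sequences are indexed from 1, as T_1, ..., T_l; T_i is None for i > l. *)
Definition entry (T : sgraph) (t : seq (rtree T)) (i : nat) : rtree T :=
  nth None t i.-1.

Definition admissible (T : sgraph) (t : seq (rtree T)) : Prop :=
  \bigcup_(R <- t) rverts R = branch T /\
  forall i j, 1 <= i <= size t -> 1 <= j <= size t -> i != j ->
    [disjoint rverts (entry t i) & rverts (entry t j)].

(* The index i >= 1 with v in V(T_i); meaningful for v in V_br(T) when t is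
   admissible, since that index is then unique. *)
Definition block (T : sgraph) (t : seq (rtree T)) (v : T) : nat :=
  (find (fun R => v \in rverts R) t).+1.

Definition sig (T : sgraph) (t : seq (rtree T)) (v : T) : nat :=
  if entry t (block t v) is Some R then dist v (root R) + block t v else 0.

(* G' is obtained from G by inserting w e new vertices into each edge e: f embeds
   the vertices of G, and q x y lists the new vertices on the edge xy, from x
   to y.  Adding vertices at the end of a pendant edge gives an isomorphic graph,
   so this also covers the extension of arms. *)
Definition subdivision (G G' : sgraph) (w : {set G} -> nat) : Prop :=
  exists (f : G -> G') (q : G -> G -> seq G'),
  [/\ injective f,
      (forall x y, adj x y ->
         [/\ q y x = rev (q x y), size (q x y) = w [set x; y], uniq (q x y)
           & forall z, z \in q x y -> z \notin codom f]),
      (forall x y x' y' z, adj x y -> adj x' y' ->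
         z \in q x y -> z \in q x' y' -> [set x; y] = [set x'; y']),
      (forall z, z \in codom f \/ exists x y, adj x y /\ z \in q x y)
    & (forall a b, adj a b <->
         exists x y, adj x y /\
           (a, b) \in zip (f x :: q x y) (rcons (q x y) (f y)))].

Definition stage1 (T : sgraph) (t : seq (rtree T)) (m : nat) (T' : sgraph)
  : Prop :=
  exists w : {set T} -> nat,
  [/\ subdivision T' w,
      (forall v p, arm v p ->
         \sum_(e <- path_edges v p) w e = m - sig t v - 1),
      (forall v v', v \in branch T -> v' \in branch T -> adj v v' ->
         block t v != block t v' ->
         w [set v; v'] = 2 * m - sig t v - sig t v')
    & (forall x y, adj x y -> w [set x; y] != 0 ->
         (exists v p, arm v p /\ [set x; y] \in path_edges v p) \/
         [/\ x \in branch T, y \in branch T & block t x != block t y])].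

(* For each i with T_i empty or i > l, d i e is the number of vertices inserted
   for i into the edge e of the arm or internal path c i of T'. *)
Definition stage2 (T : sgraph) (t : seq (rtree T)) (m : nat) (T' T'' : sgraph)
  : Prop :=
  exists (c : nat -> T' * seq T') (d : nat -> {set T'} -> nat),
  (forall i, 1 <= i <= m -> entry t i = None ->
     [/\ arm (c i).1 (c i).2 \/
           internal_path (c i).1 (c i).2 /\ size (c i).2 != 1,
         forall e, d i e != 0 -> e \in path_edges (c i).1 (c i).2
       & \sum_(e <- path_edges (c i).1 (c i).2) d i e = 2 * (m - i) + 1]) /\
  subdivision T''
    (fun e => \sum_(1 <= i < m.+1 | ~~ isSome (entry t i)) d i e).

Definition induced_by (T : sgraph) (t : seq (rtree T)) (m : nat) (T'' : sgraph)
  : Prop :=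
  exists T' : sgraph, stage1 t m T' /\ stage2 t m T' T''.

(* Main.v *)
Require Import Defs.
From mathcomp Require Import all_boot.
From mathcomp Require Import zify.

(* Orders are counted over ordered pairs of adjacent vertices, which doubles
   every edge. Write a(v) = m - sig(v). If stage 1 also inserted a(v) + a(v')
   vertices into each edge vv' inside a block, its total would depend on the
   signature only. That excess is compensated by stage 2: inside a block with
   root r the signature drops by exactly one along the edge from v <> r to its
   parent, so this edge accounts for 2 a(v) + 1 vertices, while the root of a
   nonempty T_i has signature i and accounts for the number 2 (m - i) + 1 that
   stage 2 does not insert for the index i. Together these sum to 2 a(v) + 1
   over all branch vertices v. *)

Set Implicit Arguments.
Unset Strict Implicit.
Unset Printing Implicit Defensive.

(** * Edges counted through their two orientations *)

Section Edges.

Variable G : sgraph.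
Implicit Types (x y a b r : G) (p : seq G) (w : {set G} -> nat).

Lemma adj_neq x y : adj x y -> x != y.
Proof. by apply: contraTneq => ->; rewrite adj_irrefl. Qed.

Lemma eq_set2 x y a b : [set x; y] = [set a; b] ->
  (x, y) = (a, b) \/ (x, y) = (b, a).
Proof.
move=> e.
have /set2P xP : x \in [set a; b] by rewrite -e set21.
have /set2P yP : y \in [set a; b] by rewrite -e set22.
have /set2P aP : a \in [set x; y] by rewrite e set21.
have /set2P bP : b \in [set x; y] by rewrite e set22.
by case: xP; case: yP; case: aP; case: bP => ? ? ? ?; subst; auto.
Qed.

Definition orientations (e : {set G}) : {set G * G} :=
  [set z | adj z.1 z.2 & [set z.1; z.2] == e].

Lemma card_orientations a b : adj a b -> #|orientations [set a; b]| = 2.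
Proof.
move=> ab; have -> : orientations [set a; b] = [set (a, b); (b, a)].
  apply/setP=> -[x y]; rewrite !inE /=; apply/andP/orP.
    by case=> _ /eqP/eq_set2[] [-> ->]; rewrite !eqxx; [left | right].
  by case=> /eqP[-> ->]; rewrite ?(adj_sym b) ab ?eqxx // setUC eqxx.
by rewrite cards2 xpair_eqE negb_and adj_neq.
Qed.

Lemma path_edgesP x p e : path (@adj G) x p -> e \in path_edges x p ->
  exists a b, [/\ adj a b, a \in x :: p, b \in x :: p & e = [set a; b]].
Proof.
elim: p x => [|y p IHp] x //= /andP[xy yp].
rewrite inE => /predU1P[->|/(IHp _ yp)[a [b [ab ap bp ->]]]].
  by exists x, y; rewrite !inE !eqxx ?orbT.
by exists a, b; split=> //; rewrite in_cons ?ap ?bp orbT.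
Qed.

Lemma path_edges_uniq x p :
  path (@adj G) x p -> uniq (x :: p) -> uniq (path_edges x p).
Proof.
elim: p x => [|y p IHp] x //= /andP[xy yp] /andP[xNp Up].
rewrite -/(path_edges y p) IHp // andbT.
apply: contra xNp => /(path_edgesP yp)[a [b [_ ap bp e]]].
by have /set2P[->|->] : x \in [set a; b] by rewrite -e set21.
Qed.

(** The vertices of a path are distinct, hence so are its edges. Each of them is met by exactly two
    ordered pairs, and all other pairs have weight zero. *)
Lemma sum_path_edges x p w : is_path x p ->
    (forall e, w e != 0 -> e \in path_edges x p) ->
  \sum_(z : G * G | adj z.1 z.2) w [set z.1; z.2] =
    2 * \sum_(e <- path_edges x p) w e.
Proof.
case/and3P=> _ xp Up wP; rewrite big_uniq ?path_edges_uniq //= big_distrr /=.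
(* Each weight becomes a sum over the at most one path edge equal to the pair, so that the two
   summations can be exchanged. *)
rewrite (eq_bigr (fun z : G * G =>
  \sum_(e in path_edges x p | e == [set z.1; z.2]) w e)); last first.
  move=> z _; case: (boolP ([set z.1; z.2] \in path_edges x p)) => zP.
    rewrite (big_pred1 [set z.1; z.2]) // => e /=.
    by case: eqP => [->|_]; rewrite ?zP ?andbF.
  rewrite big_pred0; first by apply/eqP; apply: contraR zP => /wP.
  by move=> e; case: eqP => [->|]; rewrite ?(negPf zP) ?andbF.
rewrite (exchange_big_dep (mem (path_edges x p))) /=; last by move=> ? ? _ /andP[].
apply: eq_bigr => e eP; have [a [b [ab _ _ def_e]]] := path_edgesP xp eP.
rewrite sum_nat_const -(card_orientations ab) -def_e; congr (_ * _).
by apply: eq_card => z; rewrite !inE eP eq_sym.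
Qed.

End Edges.

(** A vertex outside the image of [f] lies on [q x y] for a single edge, and for both of its
    orientations because [q y x] is the reverse of [q x y]. Counting pairs of an oriented edge and a
    new vertex on it thus counts every new vertex twice. *)
Lemma card_subdivision (G G' : sgraph) (w : {set G} -> nat) :
    subdivision G' w ->
  2 * #|G'| = 2 * #|G| + \sum_(z : G * G | adj z.1 z.2) w [set z.1; z.2].
Proof.
case=> f [q [f_inj qP q_disj cover _]].
rewrite -(cardC (mem (codom f))) card_codom // mulnDr; congr (_ + _).
rewrite (eq_bigr (fun z : G * G => \sum_(v in q z.1 z.2) 1)); last first.
  move=> z /qP[_ sz Uq _]; rewrite sum1_card -sz.
  exact/esym/card_uniqP.
rewrite (exchange_big_dep [predC codom f]) /=; last first.
  by move=> z v /qP[_ _ _ Nf] /Nf.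
rewrite mulnC -sum_nat_const; apply: eq_bigr => v vNf.
case: (cover v) => [vf|[x [y [xy vq]]]]; first by rewrite inE vf in vNf.
rewrite sum1_card -(card_orientations xy); apply: eq_card => -[a b].
rewrite !inE -!topredE /=; apply: andb_id2l => ab; apply/eqP/idP => [|vab].
  case/eq_set2=> [[-> ->]|[-> ->]] //.
  by have [-> _ _ _] := qP _ _ xy; rewrite mem_rev.
exact: q_disj vab vq.
Qed.

(** * Distance to a fixed vertex of a tree *)

Section Distance.

Variable G : sgraph.
Implicit Types (x y z r : G).

Lemma dist_leq x p : path (@adj G) x p -> dist x (last x p) <= size p.
Proof.
move=> xp; rewrite leqNgt; apply/negP => lt_p.
have lt_pG : size p < #|G|.
  by apply: leq_trans lt_p _; rewrite -[leqRHS](size_iota 0) find_size.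
have := before_find 0 lt_p; rewrite nth_iota // add0n => /existsP[].
by exists (in_tuple p); rewrite xp eqxx.
Qed.

Hypothesis G_tree : is_tree G.

Lemma dist_path x y : exists p,
  [/\ size p = dist x y, path (@adj G) x p & last x p = y].
Proof.
have [_ conn _] := G_tree.
have /connectP[p0 xp0 ->] := conn x y.
(* Without repeated vertices the walk has fewer than [#|G|] edges, so its length is in the range
   searched by [dist] and the default value is not taken. *)
case/shortenP: xp0 => p xp Up _.
pose P n := [exists t : n.-tuple G, path (@adj G) x t && (last x t == last x p)].
have hasP : has P (iota 0 #|G|).
  apply/hasP; exists (size p); last first.
    by apply/existsP; exists (in_tuple p); rewrite xp eqxx.
  by rewrite mem_iota /= add0n -[(size p).+1]/(size (x :: p)) -(card_uniqP Up) max_card.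
have := nth_find 0 hasP; rewrite nth_iota ?add0n; last first.
  by rewrite has_find size_iota in hasP.
by case/existsP=> t /andP[xt /eqP lt]; exists t; rewrite size_tuple lt.
Qed.

Lemma dist0 x y : dist x y = 0 -> x = y.
Proof. by move=> d0; have [[|a p] [sp xp <-]] := dist_path x y; rewrite ?d0 in sp *. Qed.

Lemma distxx x : dist x x = 0.
Proof. by apply/eqP; rewrite -leqn0; exact: (@dist_leq x [::]). Qed.

Lemma dist_step x r : x != r -> exists2 y, adj x y & (dist y r).+1 = dist x r.
Proof.
have [[|y p] [sp /= xp lp]] := dist_path x r; first by rewrite -lp eqxx.
move=> _; case/andP: xp => xy yp; exists y => //.
have [p' [sp' yp' lp']] := dist_path y r.
have := dist_leq yp; have := @dist_leq x (y :: p'); rewrite /= xy yp' lp lp' => /(_ isT).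
by move: sp => /=; lia.
Qed.

Definition adj_avoiding x : rel G := [rel y z | [&& adj y z, y != x & z != x]].

Lemma connect_avoiding_sym x : connect_sym (adj_avoiding x).
Proof. by apply: sym_connect_sym => y z;
rewrite /adj_avoiding /= adj_sym [(y != x) && _]andbC. Qed.

(** Otherwise a path from [y] to [y'] avoiding [x] would close up through [x] to a cycle with at
    least three vertices. *)
Lemma neighbour_unique x y y' : adj x y -> adj x y' ->
  connect (adj_avoiding x) y y' -> y = y'.
Proof.
have [_ _ acyclic] := G_tree => xy xy' /connectP[p0 yp0 def_y'].
case/shortenP: yp0 def_y' => [[|z p]] yp Up _ //= def_y'.
have avoid b t : path (adj_avoiding x) b t -> all (predC1 x) t.
  by elim: t b => //= a t IHt b /andP[/and3P[_ _ ->] /IHt].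
have px : all (predC1 x) [:: y, z & p].
  by move: (avoid _ _ yp); rewrite /= => ->; rewrite eq_sym adj_neq.
have /acyclic : ucycle (@adj G) [:: x, y, z & p]; last by [].
rewrite /ucycle; apply/andP; split; last first.
  rewrite cons_uniq Up andbT; apply/negP => /(allP px).
  by rewrite /= eqxx.
rewrite /cycle rcons_path /= xy -def_y' [adj y' x]adj_sym xy' andbT.
by apply: sub_path yp => a b /and3P[].
Qed.

(** Along a shortest walk from [y] to [r] every later vertex is strictly closer to [r] than [x] is,
    so the walk never meets [x]. *)
Lemma connect_avoiding x y r : y != x -> dist y r <= dist x r ->
  connect (adj_avoiding x) y r.
Proof.
elim: {y}_.+1 {-2}y (ltnSn (dist y r)) => // n IHn y le_n yx le_yx.
have [->|/dist_step[z yz dz]] := eqVneq y r; first exact: connect0.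
have zx : z != x by apply: contraTneq le_yx => <-; lia.
apply: connect_trans (IHn z _ zx _); try lia.
by apply: connect1; rewrite /adj_avoiding /= yz yx zx.
Qed.

Lemma closer_neighbour_unique x y z r : adj x y -> adj x z ->
  dist y r <= dist x r -> dist z r <= dist x r -> y = z.
Proof.
move=> xy xz le_y le_z; apply: (neighbour_unique xy xz).
apply: (@connect_trans _ _ r); last rewrite connect_avoiding_sym;
  by apply: connect_avoiding; rewrite // eq_sym adj_neq.
Qed.

(** With equal distances, [y] would coincide with the neighbour of [x] that is one step closer to
    [r]. *)
Lemma adj_dist_neq x y r : adj x y -> dist y r != dist x r.
Proof.
move=> xy; have [xr|xr] := eqVneq x r.
  rewrite xr distxx; apply: contraTneq xy => /dist0->.
  by rewrite xr adj_irrefl.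
have [z xz dz] := dist_step xr; apply/eqP => dy.
have zy : z = y by apply: (@closer_neighbour_unique x z y r) => //; lia.
by rewrite zy in dz; lia.
Qed.

(** The parent of [x] towards [r] is found in the whole tree. It lies in [U] because a path from [x]
    to [r] inside [U] leaves [x] through a neighbour that is joined to the parent away from [x],
    hence equal to it. *)
Lemma subtree_parent (U : {set G}) x r :
    is_tree (subgraph U) -> x \in U -> r \in U -> x != r ->
  exists y, [/\ y \in U, adj x y, (dist y r).+1 = dist x r
    & forall z, adj x z -> dist z r <= dist x r -> z = y].
Proof.
case=> _ connU _ xU rU xr.
have [y xy dy] := dist_step xr.
have yx : y != x by rewrite eq_sym adj_neq.
have y_r : connect (adj_avoiding x) y r by apply: connect_avoiding => //; lia.
exists y; split=> // [|z xz le_z]; last first.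
  by apply: (@closer_neighbour_unique x z y r) => //; lia.
have /connectP[p0 xp0 def_r] := connU (exist _ x xU) (exist _ r rU).
case/shortenP: xp0 def_r => [[|z p]] xp Up _ /= def_r.
  by case: def_r xr => ->; rewrite eqxx.
case/andP: xp => xz zp.
suff -> : y = val z by apply: valP.
apply: (neighbour_unique xy xz); apply: connect_trans y_r _.
rewrite connect_avoiding_sym; apply/connectP; exists (map val p); last first.
  by rewrite last_map -def_r.
case/andP: Up => xNp _ {xz connU}.
elim: p z zp xNp {def_r} => //= a s IHs z /andP[za sP] xNs.
have [xNz xNs'] : (exist _ x xU != z) /\ (exist _ x xU \notin a :: s).
  by move: xNs; rewrite inE negb_or => /andP[].
rewrite IHs // andbT; apply/and3P; split=> //; first by rewrite eq_sym -val_eqE in xNz.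
by move: xNs'; rewrite inE negb_or => /andP[]; rewrite eq_sym -val_eqE.
Qed.

End Distance.

(** * Signature sums over the roots and the edges of the blocks *)

Section Signature.

Variables (T : sgraph) (t : seq (rtree T)) (m : nat).
Hypothesis t_adm : admissible t.
Implicit Types (x y v : T).

Lemma leq_size_entry i : 0 < i -> isSome (entry t i) -> i <= size t.
Proof.
by move=> i_gt0; apply: contraTT; rewrite -ltnNge => lt_ti;
rewrite /entry nth_default // -ltnS prednK.
Qed.

Lemma mem_branch v : (v \in branch T) = has (fun R => v \in rverts R) t.
Proof.
case: t_adm => <- _; elim: t => [|R s IHs]; first by rewrite big_nil inE.
by rewrite big_cons inE IHs.
Qed.

Lemma block_entry v : v \in branch T ->
  exists2 R, entry t (block t v) = Some R & v \in verts R.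
Proof.
rewrite mem_branch => t_v.
have := nth_find None t_v; rewrite -/(entry t (block t v)).
by case: (entry t _) => [R|]; rewrite /= ?inE //; exists R.
Qed.

Lemma entry_block i R v : 0 < i -> entry t i = Some R -> v \in verts R ->
  v \in branch T /\ block t v = i.
Proof.
case: t_adm => _ disj i_gt0 t_i vR.
have le_it : i <= size t by apply: leq_size_entry; rewrite ?t_i.
have vB : v \in branch T.
  rewrite mem_branch; apply/(has_nthP None); exists i.-1; first by rewrite prednK.
  by rewrite -/(entry t i) t_i.
split=> //; have [R' t_v vR'] := block_entry vB.
have le_vt : block t v <= size t by apply: leq_size_entry; rewrite ?t_v.
apply: contraTeq vR => ne_vi.
have /(_ le_vt) := disj (block t v) i.
by rewrite i_gt0 le_it t_v t_i => /(_ isT ne_vi)/disjointFr->.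
Qed.

Definition block_root v : bool :=
  if entry t (block t v) is Some R then v == Defs.root R else false.

Hypothesis T_tree : is_tree T.

(** Sending a block root to its block index is a bijection onto the indices of nonempty entries, and
    it preserves the summand since a root has distance zero to itself. *)
Lemma sum_block_roots : (forall v, v \in branch T -> sig t v < m) ->
  \sum_(v in branch T | block_root v) (2 * (m - sig t v) + 1) =
    \sum_(1 <= i < m.+1 | isSome (entry t i)) (2 * (m - i) + 1).
Proof.
move=> lt_m; have sig_root v : block_root v -> sig t v = block t v.
  by rewrite /block_root /sig; case: entry => // R /eqP->; rewrite distxx.
apply/esym; rewrite big_nat_cond.
rewrite (eq_bigr (fun i => \sum_(v in branch T | block_root v && (block t v == i))
  (2 * (m - sig t v) + 1))); last first.
  move=> i /andP[/andP[i_gt0 _]]; case t_i: entry => [R|] // _.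
  have [rB ri] := entry_block i_gt0 t_i (root_in R).
  have rr : block_root (Defs.root R) by rewrite /block_root ri t_i eqxx.
  rewrite (big_pred1 (Defs.root R)) ?sig_root ?ri // => v /=.
  apply/and3P/eqP => [[_ + /eqP vi]|->]; last by rewrite ri.
  by rewrite /block_root vi t_i => /eqP.
rewrite (exchange_big_dep (fun v => (v \in branch T) && block_root v)) /=; last first.
  by move=> i v _ /and3P[-> ->].
apply: eq_bigr => v /andP[vB rv].
have [R t_v _] := block_entry vB.
(* The bound on the signature is what keeps the indices of nonempty entries within the range up to
   [m]. *)
have lt_bm : block t v < m.+1 by rewrite ltnS -sig_root // ltnW ?lt_m.
rewrite (eq_bigl (pred1 (block t v))) => [|i]; last first.
  by rewrite /= vB rv /= eq_sym; case: eqP => [->|]; rewrite ?andbF // lt_bm t_v.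
by rewrite -big_filter filter_pred1_uniq ?iota_uniq ?mem_index_iota // big_seq1.
Qed.

Lemma adj_sig_neq x y : x \in branch T -> y \in branch T -> adj x y ->
  block t y = block t x -> sig t y != sig t x.
Proof.
move=> xB yB xy eq_b; have [R t_x _] := block_entry xB.
by rewrite /sig eq_b t_x eqn_add2r adj_dist_neq.
Qed.

(** The only possible term is the parent of [x] in its block. Its signature is [sig t x - 1], which
    produces the odd summand; a root has no parent. *)
Lemma sum_lower_neighbours x : x \in branch T -> sig t x < m ->
  \sum_(y | [&& adj x y, y \in branch T, block t y == block t x
               & sig t y < sig t x]) (2 * m - sig t x - sig t y) =
    if block_root x then 0 else 2 * (m - sig t x) + 1.
Proof.
move=> xB lt_m; have [R t_x xR] := block_entry xB.
have sigE y : block t y = block t x -> sig t y = dist y (Defs.root R) + block t x.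
  by move=> eq_b; rewrite /sig eq_b t_x.
rewrite /block_root t_x; case: eqP => [x_root|/eqP x_root].
  rewrite big_pred0 // => y; apply/and4P => -[_ _ /eqP eq_b].
  by rewrite (sigE x) // (sigE y) // x_root distxx; lia.
have [y [yR xy dy y_uniq]] :=
  subtree_parent T_tree (verts_tree R) xR (root_in R) x_root.
have [yB by_x] := entry_block (ltn0Sn _) t_x yR.
have sy : (sig t y).+1 = sig t x by rewrite (sigE x) // (sigE y) // -dy.
rewrite (big_pred1 y) => [|z /=]; first lia.
apply/and4P/eqP => [[xz zB /eqP bz lt_z]|->]; last by rewrite by_x -sy.
by apply: y_uniq => //; move: lt_z; rewrite (sigE x) // (sigE z) //; lia.
Qed.

(** Adjacent vertices of one block have different signatures, so every edge inside a block has one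
    descending and one ascending orientation. Swapping the ends matches the two halves, and the
    descending half is summed at the upper end. *)
Lemma sum_same_block : (forall v, v \in branch T -> sig t v < m) ->
  \sum_(z : T * T | [&& adj z.1 z.2, z.1 \in branch T, z.2 \in branch T
                     & block t z.2 == block t z.1])
      (2 * m - sig t z.1 - sig t z.2) =
    2 * \sum_(v in branch T | ~~ block_root v) (2 * (m - sig t v) + 1).
Proof.
move=> lt_m; pose P (z : T * T) := [&& adj z.1 z.2, z.1 \in branch T,
  z.2 \in branch T & block t z.2 == block t z.1].
rewrite (eq_bigl P) //.
have low : \sum_(z | P z && (sig t z.2 < sig t z.1)) (2 * m - sig t z.1 - sig t z.2) =
    \sum_(v in branch T | ~~ block_root v) (2 * (m - sig t v) + 1).
  rewrite [RHS]big_mkcondr /=.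
  rewrite [RHS](eq_bigr (fun x => \sum_(y | [&& adj x y, y \in branch T,
     block t y == block t x & sig t y < sig t x]) (2 * m - sig t x - sig t y))) /=.
    rewrite pair_big_dep /=; apply: eq_bigl => -[x y]; rewrite /P /=.
    by case: (adj x y); case: (x \in _); case: (y \in _).
  by move=> v vB; rewrite sum_lower_neighbours ?lt_m //; case: block_root.
rewrite (bigID (fun z : T * T => sig t z.2 < sig t z.1)) /= low [RHS]mul2n -[RHS]addnn.
congr (_ + _).
rewrite -low; pose swap (z : T * T) := (z.2, z.1).
have swapK : involutive swap by case.
rewrite (reindex_inj (inv_inj swapK)) /=; apply: eq_big => [[x y]|[x y] _] /=; last by lia.
rewrite /P /= adj_sym (eq_sym (block t x)).
case xy: (adj x y) => //=; case xB: (x \in _); case yB: (y \in _) => //=.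
case: eqP => //= eq_b; have := adj_sig_neq xB yB xy eq_b; lia.
Qed.

End Signature.

(* The number of vertices stage 1 would insert into the edge [xy] if all the
   blocks were single vertices; it depends on the signature [sg] only. *)
Definition full_extension (T : sgraph) (sg : T -> nat) (m : nat) (x y : T) : nat :=
  if x \in branch T then
    if y \in branch T then 2 * m - sg x - sg y else m - sg x - 1
  else if y \in branch T then m - sg y - 1 else 0.

(** * Orders after the two stages of the construction *)

Section Induced.

Variables (T : sgraph) (t : seq (rtree T)) (m : nat).
Hypotheses (T_tree : is_tree T) (T_irr : homeo_irreducible T).
Hypotheses (t_adm : admissible t).
Hypothesis lt_m : forall v, v \in branch T -> sig t v < m.

Lemma leaf_not_branch (x : T) : leaf x -> x \notin branch T.
Proof. by rewrite inE /leaf => /eqP->. Qed.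

Lemma adj_leaf (x y : T) : adj x y -> y \notin branch T -> leaf y.
Proof.
move=> xy; have := T_irr y; rewrite inE /leaf.
have : 0 < deg y by rewrite card_gt0; apply/set0Pn; exists x; rewrite inE adj_sym.
lia.
Qed.

(** An interior vertex of an arm would be a leaf by irreducibility, yet have two distinct neighbours
    on the arm. *)
Lemma arm_pendant_edge (v : T) p : arm v p ->
  exists y, [/\ p = [:: y], adj v y, v \in branch T & leaf y].
Proof.
case/and4P=> /and3P[+ vp Up] vB.
case: p vp Up => [|y [|z p]] //= /andP[vy yp] Up _ y_leaf.
  by exists y.
case/andP=> /(adj_leaf vy)/cards1P[a def_a] _; have /andP[yz _] := yp.
have : v \in [set a] by rewrite -def_a inE adj_sym.
have : z \in [set a] by rewrite -def_a inE.
by rewrite !inE => /eqP za /eqP va; move: Up; rewrite va za !inE eqxx orbT.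
Qed.

Lemma stage1_weight (w : {set T} -> nat) :
    (forall v p, arm v p ->
      \sum_(e <- path_edges v p) w e = m - sig t v - 1) ->
    (forall v v', v \in branch T -> v' \in branch T -> adj v v' ->
      block t v != block t v' ->
      w [set v; v'] = 2 * m - sig t v - sig t v') ->
    (forall x y, adj x y -> w [set x; y] != 0 ->
      (exists v p, arm v p /\ [set x; y] \in path_edges v p) \/
      [/\ x \in branch T, y \in branch T & block t x != block t y]) ->
  forall x y, adj x y ->
    w [set x; y] + (if [&& x \in branch T, y \in branch T & block t y == block t x]
                    then 2 * m - sig t x - sig t y else 0)
      = full_extension (sig t) m x y.
Proof.
move=> w_arm w_int w_supp.
have w_pendant x y : x \in branch T -> y \notin branch T -> adj x y ->
    w [set x; y] = m - sig t x - 1.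
  move=> xB yNB xy; rewrite -(w_arm x [:: y]) ?big_seq1 //.
  by rewrite /arm /is_path /= xy xB (adj_leaf xy) // !inE adj_neq.
(* This covers the edges inside a block and an edge joining two leaves; neither kind is in the
   support allowed to [w]. *)
have w0 x y : adj x y -> (x \in branch T) = (y \in branch T) ->
    (x \in branch T -> block t x = block t y) -> w [set x; y] = 0.
  move=> xy eqB eq_b; apply/eqP; apply: contraT => /(w_supp _ _ xy)[|[xB _]].
    case=> v [p [/arm_pendant_edge[u [-> vu vB u_leaf]]]].
    rewrite inE => /eqP/eq_set2[][xv yu]; move: eqB (leaf_not_branch u_leaf).
      by rewrite -yu xv => <-; rewrite vB.
    by rewrite -xv yu vB => ->.
  by rewrite eq_b ?eqxx.
move=> x y xy; rewrite /full_extension.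
case: (boolP (x \in branch T)) => xB; case: (boolP (y \in branch T)) => yB /=.
- case: eqP => [eq_b|/eqP ne_b]; last by rewrite w_int 1?eq_sym ?addn0.
  by rewrite w0 // xB yB.
- by rewrite w_pendant ?addn0.
- by rewrite setUC w_pendant ?addn0 // adj_sym.
- by rewrite w0 ?(negPf xB) ?(negPf yB).
Qed.

Lemma order_stage1 T' : stage1 t m T' ->
  2 * #|T'| + 2 * \sum_(v in branch T | ~~ block_root t v) (2 * (m - sig t v) + 1) =
    2 * #|T| + \sum_(z : T * T | adj z.1 z.2) full_extension (sig t) m z.1 z.2.
Proof.
case=> w [sub_w w_arm w_int w_supp].
rewrite (card_subdivision sub_w) -(sum_same_block t_adm) // -addnA; congr (_ + _).
rewrite [X in _ + X]big_mkcondr -big_split; apply: eq_bigr => -[x y] xy /=.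
exact: stage1_weight.
Qed.

(** Exchanging the sums over edges and indices isolates the contribution of each index, which is
    supported on its own chosen path; which path was chosen does not affect the total. *)
Lemma order_stage2 T' T'' : stage2 t m T' T'' ->
  #|T''| = #|T'| + \sum_(1 <= i < m.+1 | ~~ isSome (entry t i)) (2 * (m - i) + 1).
Proof.
case=> c [d [dP sub_d]]; apply/eqP; rewrite -(eqn_pmul2l (isT : 0 < 2)); apply/eqP.
rewrite (card_subdivision sub_d) mulnDr; congr (_ + _).
rewrite exchange_big /= big_distrr /= big_nat_cond [RHS]big_nat_cond.
apply: eq_bigr => i /andP[i_le t_i].
have {}t_i : entry t i = None by case: (entry t i) t_i.
have [c_path d_supp <-] := dP _ i_le t_i.
apply: sum_path_edges d_supp.
by case: c_path => [/and4P[]|[/and4P[]]].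
Qed.

(** The root terms supply the indices missing from stage 2, which completes the last sum to all
    indices from 1 to [m]. Apart from [#|T''|], everything left depends only on [T], [m] and the
    signature on branch vertices. *)
Lemma order_induced T'' : induced_by t m T'' ->
  2 * #|T''| + 2 * \sum_(v in branch T) (2 * (m - sig t v) + 1) =
    2 * #|T| + \sum_(z : T * T | adj z.1 z.2) full_extension (sig t) m z.1 z.2
    + 2 * \sum_(1 <= i < m.+1) (2 * (m - i) + 1).
Proof.
case=> T' [/order_stage1 o1 /order_stage2 o2].
rewrite (bigID (block_root t)) /= sum_block_roots // -o1 o2.
by rewrite [in RHS](bigID (fun i => isSome (entry t i))) /=; lia.
Qed.

End Induced.

Theorem theorem3p11 (T : sgraph) (s s' : seq (rtree T))
    (hT : is_tree T) (hirr : homeo_irreducible T)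
    (hs : admissible s) (hs' : admissible s')
    (hsig : forall v : T, v \in branch T -> sig s v = sig s' v)
    (m : nat) (hm : forall v : T, v \in branch T -> sig s v < m)
    (T1 T2 : sgraph) (hT1 : induced_by s m T1) (hT2 : induced_by s' m T2) :
  #|T1| = #|T2|.
Proof.
have hm' v : v \in branch T -> sig s' v < m by move=> vB; rewrite -hsig ?hm.
have := order_induced hT hirr hs hm hT1.
have := order_induced hT hirr hs' hm' hT2.
have -> : \sum_(v in branch T) (2 * (m - sig s v) + 1) =
          \sum_(v in branch T) (2 * (m - sig s' v) + 1).
  by apply: eq_bigr => v /hsig->.
have -> : \sum_(z : T * T | adj z.1 z.2) full_extension (sig s) m z.1 z.2 =
          \sum_(z : T * T | adj z.1 z.2) full_extension (sig s') m z.1 z.2.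
  apply: eq_bigr => -[x y] _; rewrite /full_extension /=.
  by case: ifP => [/hsig->|_]; case: ifP => // /hsig->.
lia.
Qed.
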